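(* Let $\mathfrak{S} = \{0\}\cup\{f\in\mathbb{Z}[x] \mid f(0)>0\}$. Then $\mathfrak{S}$ is a semidomain that is bi-HFS, i.e., both the additive monoid $(\mathfrak{S},+)$ and the multiplicative monoid $\mathfrak{S}^*=\mathfrak{S}\setminus\{0\}$ are half-factorial. Moreover, $\mathfrak{S}$ is isomorphic, as a semiring, to a subsemiring of $\mathbb{R}$ different from $\mathbb{N}_0$.
   Context: $\mathbb{N}_0=\{0,1,2,\dots\}$. A semidomain is a subset of an integral domain that contains $0$ and $1$ and is closed under addition and multiplication (with the inherited operations). A subsemiring of $\mathbb{R}$ is a subset containing $0$ and $1$ and closed under addition and multiplication. For a cancellative commutative monoid $M$, an atom is a nonunit $a\in M$ that cannot be written as a product (sum, in additive notation) of two nonunits; $M$ is atomic if every nonunit is a finite product (sum) of atoms. An atomic monoid $M$ is half-factorial if, for each $b\in M$, all factorizations of $b$ into atoms have the same number of factors, counted with multiplicity (units having length $0$). A semidomain $\mathfrak{S}$ is bi-HFS if both monoids $(\mathfrak{S},+)$ and $(\mathfrak{S}\setminus\{0\},\cdot)$ are half-factorial. *)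

(* Defs.v *)
From HB Require Import structures.
From mathcomp Require Import all_boot all_order all_algebra.
From mathcomp Require Import reals.

Set Implicit Arguments.
Unset Strict Implicit.
Unset Printing Implicit Defensive.

Import Order.TTheory GRing.Theory Num.Theory.
Local Open Scope ring_scope.

(* The monoid under study is the subset M of T with the operation op and the
   neutral element e.  All notions below are relative to M: inverses, divisors
   and atoms are taken in M, not in the ambient type T. *)

Definition unit_in (T : eqType) (e : T) (op : Monoid.com_law e)
    (M : {pred T}) (u : T) : Prop :=
  u \in M /\ exists2 v, v \in M & op u v = e.

Definition nonunit_in (T : eqType) (e : T) (op : Monoid.com_law e)
    (M : {pred T}) (a : T) : Prop :=
  a \in M /\ ~ unit_in op M a.

Definition atom_in (T : eqType) (e : T) (op : Monoid.com_law e)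
    (M : {pred T}) (a : T) : Prop :=
  nonunit_in op M a /\
  ~ (exists b c, [/\ nonunit_in op M b, nonunit_in op M c & a = op b c]).

Definition atomic_monoid (T : eqType) (e : T) (op : Monoid.com_law e)
    (M : {pred T}) : Prop :=
  forall b, nonunit_in op M b ->
    exists2 s : seq T, {in s, forall a, atom_in op M a} &
      b = \big[op/e]_(a <- s) a.

(* A factorization is taken up to a unit of M, so that the factorization of a
   unit is the empty sequence, of length 0. *)
Definition factorization_in (T : eqType) (e : T) (op : Monoid.com_law e)
    (M : {pred T}) (b : T) (s : seq T) : Prop :=
  {in s, forall a, atom_in op M a} /\
  exists2 u, unit_in op M u & b = op u (\big[op/e]_(a <- s) a).

Definition half_factorial (T : eqType) (e : T) (op : Monoid.com_law e)
    (M : {pred T}) : Prop :=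
  atomic_monoid op M /\
  {in M, forall b, forall s t : seq T,
    factorization_in op M b s -> factorization_in op M b t ->
    size s = size t}.

Definition semidomain (D : idomainType) (S : {pred D}) : Prop :=
  semiring_closed S.

Definition bi_HFS (D : idomainType) (S : {pred D}) : Prop :=
  half_factorial (+%R : Monoid.com_law (0 : D)) S /\
  half_factorial ( *%R : Monoid.com_law (1 : D)) [predD1 S & 0].

(* phi is defined on the ambient type A, but only its restriction to S is
   constrained. *)
Definition semiring_isomorphic (A B : pzSemiRingType)
    (S : {pred A}) (T : {pred B}) : Prop :=
  exists phi : A -> B,
    [/\ phi 0 = 0 /\ phi 1 = 1,
        {in S &, {morph phi : f g / f + g}},
        {in S &, {morph phi : f g / f * g}},
        {in S &, injective phi} &
        forall y, y \in T <-> exists2 f, f \in S & phi f = y].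

Definition pos_const_poly : {pred {poly int}} :=
  [pred f : {poly int} | (f == 0) || (0 < f.[0])].

(* Main.v *)
Require Import Defs.
From HB Require Import structures.
From mathcomp Require Import all_boot all_order all_algebra.
From mathcomp Require Import boolp classical_sets functions cardinality finmap.
From mathcomp Require Import reals ereal measure lebesgue_measure.

Set Implicit Arguments.
Unset Strict Implicit.
Unset Printing Implicit Defensive.

Import Order.TTheory GRing.Theory Num.Theory.
Local Open Scope ring_scope.

(** The additive atoms are the f with f(0) = 1, so an additive factorization of
    f has length f(0).  The multiplicative atoms are the irreducible elements
    of Z[x] with positive constant term, and they are prime: for constants by
    multiplicativity of the content, for the others by Gauss's lemma together
    with the Euclidean property over Q.  Since the only unit is 1, every
    multiplicative factorization is unique.  Evaluation at a real transcendental
    number (which exists because the algebraic numbers are countable, hence of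
    measure zero) embeds Z[x] in R, and the image of x + 1 is not a natural
    number. *)

(** * Existence of a transcendental real number *)

Section Transcendental.

Local Open Scope classical_set_scope.

Lemma finite_roots (R : idomainType) (p : {poly R}) :
  p != 0 -> finite_set [set x | root p x].
Proof.
move=> p0; apply: contrapT => /(@infinite_set_fset _ _ (size p))[B Bp sizeB].
have : (size B < size p)%N.
  apply: max_poly_roots => //; last exact: fset_uniq.
  by apply/allP => x xB; exact: Bp.
by rewrite ltnNge sizeB.
Qed.

Lemma exists_transcendental (R : realType) : exists alpha : R,
  forall p : {poly int}, root (map_poly intr p) alpha -> p = 0.
Proof.
apply: contrapT => algR.
pose roots (p : {poly int}) := [set x : R | root (map_poly intr p) x].
have cR : countable (\bigcup_(p in [set p | p != 0]) roots p).
  apply: bigcup_countable => [|p /= p0]; first exact: countableP.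
  apply: finite_set_countable; apply: finite_roots.
  rewrite map_poly_eq0_id0 ?p0 // intr_eq0 lead_coef_eq0 //.
(* Were every real algebraic, [0, 1] would lie in this countable union and have measure 0 instead of
   1. *)
have /sub_countable/(_ cR)/countable_lebesgue_measure0 :
    ([set` `[0%R, 1%R : R]%R] #<= \bigcup_(p in [set p | p != 0]) roots p)%card.
  apply: subset_card_le => x _; apply: contrapT => nx.
  apply: algR; exists x => p px; apply: contrapT => /eqP p0.
  by apply: nx; exists p.
rewrite lebesgue_measure_itv /= lte_fin ltr01 oppr0 adde0 => /eqP.
by rewrite eqe oner_eq0.
Qed.

End Transcendental.

(** * Membership and closure properties *)

Local Notation Sstar := [predD1 pos_const_poly & 0].

Lemma mem_pos_const_poly (f : {poly int}) :
  (f \in pos_const_poly) = (f == 0) || (0 < f.[0]).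
Proof. by []. Qed.

Lemma mem_pos_const_polyD0 (f : {poly int}) : (f \in Sstar) = (0 < f.[0]).
Proof.
by rewrite inE /= mem_pos_const_poly; case: eqVneq => [->|]; rewrite ?horner0.
Qed.

Lemma pos_const_poly_ge0 (f : {poly int}) : f \in pos_const_poly -> 0 <= f.[0].
Proof.
by rewrite mem_pos_const_poly => /orP[/eqP->|/ltW//]; rewrite horner0.
Qed.

Lemma pos_const_poly_eq0 (f : {poly int}) :
  f \in pos_const_poly -> (f == 0) = (f.[0] == 0).
Proof.
rewrite mem_pos_const_poly; case: eqVneq => [->|_ /= /lt0r_neq0/negPf->//].
by rewrite horner0 eqxx.
Qed.

Lemma semidomain_pos_const_poly : semidomain pos_const_poly.
Proof.
split; split; rewrite ?mem_pos_const_poly ?eqxx ?hornerC ?orbT //.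
  move=> f g; rewrite !mem_pos_const_poly => /orP[/eqP->|f0] /orP[/eqP->|g0];
    by rewrite ?add0r ?addr0 ?eqxx ?g0 ?f0 ?orbT // hornerD addr_gt0 ?orbT.
move=> f g; rewrite !mem_pos_const_poly => /orP[/eqP->|f0] /orP[/eqP->|g0];
  by rewrite ?mul0r ?mulr0 ?eqxx // hornerM mulr_gt0 ?orbT.
Qed.

(** * The additive monoid *)

Local Notation addS := (+%R : Monoid.com_law (0 : {poly int})).
Local Notation mulS := ( *%R : Monoid.com_law (1 : {poly int})).

Lemma add_unitE (f : {poly int}) : unit_in addS pos_const_poly f <-> f = 0.
Proof.
have S0 : 0 \in pos_const_poly by rewrite mem_pos_const_poly eqxx.
split=> [[fS [g gS /= fg0]]|->]; last first.
  by split=> //; exists 0; rewrite /= ?addr0.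
apply/eqP; rewrite pos_const_poly_eq0 //.
have : (f + g).[0] == 0 by rewrite fg0 horner0.
by rewrite hornerD paddr_eq0 ?pos_const_poly_ge0 // => /andP[].
Qed.

Lemma add_nonunitE (f : {poly int}) :
  nonunit_in addS pos_const_poly f <-> 0 < f.[0].
Proof.
rewrite /nonunit_in add_unitE mem_pos_const_poly.
split=> [[/orP[/eqP//|//]]|f0].
by split; [rewrite f0 orbT|move=> fE; rewrite fE horner0 in f0].
Qed.

(** If f(0) > 1, then f = (f - 1) + 1 splits [f] into nonunits; conversely, a sum of two nonunits
    has constant term at least 2. *)
Lemma add_atomE (f : {poly int}) : atom_in addS pos_const_poly f <-> f.[0] = 1.
Proof.
rewrite /atom_in add_nonunitE; split=> [[f0 fI]|f1].
  apply/eqP; rewrite eq_le -gtz0_ge1 f0 andbT leNgt; apply/negP => f1.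
  apply: fI; exists (f - 1), 1; split; last by rewrite /= subrK.
    by apply/add_nonunitE; rewrite !hornerE subr_gt0.
  by apply/add_nonunitE; rewrite hornerC.
rewrite f1; split=> // -[b [c [/add_nonunitE b0 /add_nonunitE c0 fbc]]].
move: f1; rewrite fbc hornerD => bc1.
by move: b0 c0; rewrite !gtz0_ge1 => b1 /(lerD b1); rewrite bc1.
Qed.

Lemma sum_add_atoms (s : seq {poly int}) :
  {in s, forall f, atom_in addS pos_const_poly f} ->
  (\sum_(f <- s) f).[0] = (size s)%:R.
Proof.
elim: s => [|f s IHs] sA; first by rewrite big_nil horner0.
rewrite big_cons hornerD IHs => [|g gs]; last by apply: sA; rewrite inE gs orbT.
by rewrite (add_atomE f).1 ?nat1r //; apply: sA; rewrite mem_head.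
Qed.

Lemma half_factorial_add : half_factorial addS pos_const_poly.
Proof.
split=> [f /add_nonunitE f0|f _ s t [sA [u]]].
  have [n fn] : exists n, f.[0] = n.+1%:R.
    by exists `|f.[0]|.-1%N; rewrite prednK ?absz_gt0 ?lt0r_neq0 // natz
      gtz0_abs.
  (* One atom carries all nonconstant terms of [f]; the other n are the constant 1. *)
  exists ((f - n%:R) :: nseq n 1).
    move=> g; rewrite inE => /predU1P[->|/nseqP[-> _]]; apply/add_atomE.
      by rewrite hornerD hornerN -polyCMn hornerC fn -natr1 addrAC subrr add0r.
    by rewrite hornerC.
  by rewrite big_cons big_nseq iter_addr addr0 /= subrK.
move=> /add_unitE-> /= -> [tA [v /add_unitE-> /=]]; rewrite !add0r => st.
apply/eqP; rewrite -(eqr_nat int) -(sum_add_atoms sA) -(sum_add_atoms tA).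
by rewrite st.
Qed.

(** * Units and atoms of the multiplicative monoid *)

Lemma unitz_absz (k : int) : (k \is a GRing.unit) = (`|k| == 1)%N.
Proof.
by case: k => [k|[|k]]; rewrite -[LHS]/((_ == 1) || (_ == -1)) ?orbF.
Qed.

(** The units of Z[x] are the constants 1 and -1, and the sign excludes -1. *)
Lemma unit_pos_eq1 (f : {poly int}) : f \is a GRing.unit -> 0 < f.[0] -> f = 1.
Proof.
rewrite poly_unitE => /andP[/eqP f1].
rewrite [f]size1_polyC ?f1 // hornerC coefC /=.
by rewrite unitz_absz; case: (f`_0) => // n /eqP/= ->.
Qed.

Lemma mul_unitE (f : {poly int}) : unit_in mulS Sstar f <-> f = 1.
Proof.
have S1 : 1 \in Sstar by rewrite mem_pos_const_polyD0 hornerC.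
split=> [[fS [g _ /= fg1]]|->]; last by split=> //; exists 1; rewrite /= ?mulr1.
rewrite mem_pos_const_polyD0 in fS; apply: unit_pos_eq1 => //.
by apply/unitrPr; exists g.
Qed.

Lemma mul_nonunitE (f : {poly int}) :
  nonunit_in mulS Sstar f <-> 0 < f.[0] /\ f <> 1.
Proof. by rewrite /nonunit_in mul_unitE mem_pos_const_polyD0. Qed.

(* If both factors have negative constant term, negate them. *)
Lemma mul_atom_irreducible (a g h : {poly int}) : atom_in mulS Sstar a ->
  a = g * h -> g \is a GRing.unit \/ h \is a GRing.unit.
Proof.
case=> [/mul_nonunitE[a0 _] aI].
wlog g0 : g h / 0 < g.[0] => [IH agh|].
  have : g.[0] != 0.
    by apply: contraTneq a0; rewrite agh hornerM => ->; rewrite mul0r.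
  rewrite neq_lt => /orP[g0|/IH]; last by apply.
  by rewrite -(unitrN g) -(unitrN h); apply: IH;
    rewrite ?hornerN ?oppr_gt0 ?mulrNN.
move=> agh; have h0 : 0 < h.[0] by move: a0; rewrite agh hornerM pmulr_rgt0.
have [->|g1] := eqVneq g 1; first by left; exact: unitr1.
have [->|h1] := eqVneq h 1; first by right; exact: unitr1.
case: aI; exists g, h; split=> //; apply/mul_nonunitE; split=> //; exact/eqP.
Qed.

Lemma mul_atomN_unit (a : {poly int}) : atom_in mulS Sstar a ->
  a \isn't a GRing.unit.
Proof.
case=> /mul_nonunitE[a0 a1] _; apply/negP => aU; exact/a1/unit_pos_eq1.
Qed.

(** * Multiplicative atoms are prime in Z[x] *)

Lemma dvdz_zcontentsP (k : int) (f : {poly int}) :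
  (k %| zcontents f)%Z -> exists r, f = k%:P * r.
Proof.
move=> /dvdzP[q fE]; exists (q *: zprimitive f).
by rewrite mul_polyC scalerA mulrC -fE -zpolyEprim.
Qed.

(** Write k = e * gcd(k, content of b). By irreducibility one factor is a unit: if it is [e], then
    [k] divides the content of [b]; if it is the gcd, then [k] is coprime to that content and
    divides the content of [c]. *)
Lemma const_atom_prime (k : int) (b c d : {poly int}) :
  atom_in mulS Sstar k%:P -> b * c = k%:P * d ->
  (exists r, b = k%:P * r) \/ (exists r, c = k%:P * r).
Proof.
move=> kA bcE; have kbc : (k %| zcontents b * zcontents c)%Z.
  by rewrite -zcontentsM bcE mul_polyC zcontentsZ dvdz_mulr.
have [e kE] := dvdzP (dvdz_gcdl k (zcontents b)).
have := mul_atom_irreducible kA (g := e%:P) (h := (gcdz k (zcontents b))%:P).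
rewrite -polyCM -kE !poly_unitE !coefC /= => /(_ erefl)[] /andP[_ U].
  left; apply: dvdz_zcontentsP; rewrite {1}kE.
  move: U; rewrite unitz_absz => /eqP e1.
  by rewrite dvdzE abszM e1 mul1n -dvdzE dvdz_gcdr.
right; apply: dvdz_zcontentsP; rewrite -(Gauss_dvdzr _ (n := zcontents b)) //.
by move: U; rewrite unitz_absz /coprimez.
Qed.

(** Here [%|] is divisibility up to a nonzero integer factor, that is, over Q. By Gauss's lemma the
    primitive part of [a] divides [f] in Z[x], and the content of the nonconstant irreducible [a] is
    a unit. *)
Lemma nonconst_atom_dvdpP (a f : {poly int}) : atom_in mulS Sstar a ->
  (1 < size a)%N -> a %| f -> exists r, f = a * r.
Proof.
move=> aA a1 /dvdpP_int[r ->].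
have := mul_atom_irreducible aA (g := (zcontents a)%:P) (h := zprimitive a).
rewrite mul_polyC -zpolyEprim => /(_ erefl)[|]; last first.
  by rewrite poly_unitE size_zprimitive gtn_eqF.
move: (zpolyEprim a); rewrite -mul_polyC.
move: (zcontents a)%:P (zprimitive a) => k q aE kU.
by exists (k^-1 * r); rewrite aE mulrACA divrr ?mul1r.
Qed.

(** Irreducibility passes from Z to Q: the primitive part of a divisor over Q divides [a] in Z[x]
    and is not a unit, so its cofactor is a unit and the sizes agree. *)
Lemma nonconst_atom_irreducible_poly (a : {poly int}) :
  atom_in mulS Sstar a -> (1 < size a)%N -> irreducible_poly a.
Proof.
move=> aA a1; split=> // g g1 ga; rewrite -dvdp_size_eqp //.
have [r aE] := dvdpP_int ga; have := mul_atom_irreducible aA aE.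
rewrite !poly_unitE size_zprimitive (negPf g1) /= => -[//|/andP[/eqP r1 _]].
have a0 : a != 0 by rewrite -size_poly_gt0 ltnW.
have /norP[g0 r0] : ~~ ((zprimitive g == 0) || (r == 0)).
  by rewrite -mulf_eq0 -aE.
by rewrite [in size a]aE size_mul // r1 addn1 size_zprimitive.
Qed.

(** The other factors range over all of Z[x]; the sign of a cofactor is recovered only when
    factorizations are compared. *)
Lemma mul_atom_prime (a b c d : {poly int}) :
  atom_in mulS Sstar a -> b * c = a * d ->
  (exists r, b = a * r) \/ (exists r, c = a * r).
Proof.
move=> aA bcE; have [a1|a1] := leqP (size a) 1.
  by move: aA bcE; rewrite [a]size1_polyC //; exact: const_atom_prime.
have : a %| b * c by rewrite bcE dvdp_mulr.
have [ab _|ab] := boolP (a %| b); first by left; exact: nonconst_atom_dvdpP.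
(* Over Q, an irreducible polynomial not dividing [b] is coprime to it, hence divides [c]. *)
rewrite Gauss_dvdpr => [ac|]; first by right; exact: nonconst_atom_dvdpP.
by rewrite irreducible_poly_coprime //; exact: nonconst_atom_irreducible_poly.
Qed.

(** * Comparison of multiplicative factorizations *)

Lemma mul_atom_prime_prod (a d : {poly int}) (s : seq {poly int}) :
  atom_in mulS Sstar a -> \prod_(f <- s) f = a * d ->
  exists2 b, b \in s & exists r, b = a * r.
Proof.
move=> aA; elim: s d => [d|f s IHs d].
  rewrite big_nil => /esym ad; have /negP[] := mul_atomN_unit aA.
  by apply/unitrPr; exists d.
rewrite big_cons => /(mul_atom_prime aA)[fr|[r /IHs[b bs br]]].
  by exists f; rewrite ?mem_head.
by exists b; rewrite // inE bs orbT.
Qed.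

(** By primality the head of [s] divides some member of [t]; the two are in fact equal, so they
    cancel and induction applies. *)
Lemma mul_atom_factorization_size (s t : seq {poly int}) :
  {in s, forall f, atom_in mulS Sstar f} ->
  {in t, forall f, atom_in mulS Sstar f} ->
  \prod_(f <- s) f = \prod_(f <- t) f -> size s = size t.
Proof.
elim: s t => [|a s IHs] t sA tA.
  case: t tA => // b t tA; rewrite big_nil big_cons => /esym bt.
  have /negP[] := mul_atomN_unit (tA b (mem_head _ _)).
  by apply/unitrPr; exists (\prod_(f <- t) f).
have aA := sA a (mem_head _ _).
rewrite big_cons => stE.
have [b bt [r bE]] := mul_atom_prime_prod aA (esym stE).
have [[/mul_nonunitE[a0 _] _] [/mul_nonunitE[b0 _] _]] := (aA, tA b bt).
(* The atom [b] is irreducible and [a] is not a unit, so [r] is a unit; its constant term is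
   positive like those of [a] and [b]. *)
have r1 : r = 1.
  have [] := mul_atom_irreducible (tA b bt) bE.
    by rewrite (negPf (mul_atomN_unit aA)).
  by move/unit_pos_eq1; apply; move: b0; rewrite bE hornerM pmulr_rgt0.
have abE : b = a by rewrite bE r1 mulr1.
rewrite {b bE b0}abE in bt.
move: stE; rewrite (perm_big _ (perm_to_rem bt)) big_cons.
have an0 : a != 0 by apply: contraTneq a0 => ->; rewrite horner0.
move=> /(mulfI an0)/IHs stE /=; rewrite stE => [|f fs|f /mem_rem]; last 2 first.
- by apply: sA; rewrite inE fs orbT.
- exact: tA.
by rewrite size_rem // prednK // -has_predT; apply/hasP; exists a.
Qed.

(** * Existence of multiplicative factorizations *)

Definition norm_size (f : {poly int}) : nat := (size f + `|f.[0]|)%N.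

(** A nonconstant [c] raises the size, a constant [c] at least 2 raises the constant term, and
    neither summand ever drops; this makes the sum a measure for induction on proper factors. *)
Lemma norm_size_lt_mul (b c : {poly int}) : 0 < b.[0] -> 0 < c.[0] -> c <> 1 ->
  (norm_size b < norm_size (b * c))%N.
Proof.
move=> b0 c0 c1.
have bn0 : b != 0 by apply: contraTneq b0 => ->; rewrite horner0.
have cn0 : c != 0 by apply: contraTneq c0 => ->; rewrite horner0.
have [ab ac] : (0 < `|b.[0]|)%N /\ (0 < `|c.[0]|)%N.
  by rewrite !absz_gt0 !lt0r_neq0.
rewrite /norm_size size_mul // hornerM abszM.
have [c_le1|c_gt1] := leqP (size c) 1.
  have -> : size c = 1%N by apply/eqP; rewrite eqn_leq c_le1 size_poly_gt0.
  rewrite addn1 /= ltn_add2l ltn_Pmulr //.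
  move: c0 c1; rewrite [c]size1_polyC // hornerC.
  by case: (c`_0) => // -[|[|k]].
apply: leq_trans (leq_add (leqnn _) (leq_pmulr _ ac)).
rewrite ltn_add2r -subn1 -addnBA ?(ltnW c_gt1) //.
by rewrite -[X in (X < _)%N]addn0 ltn_add2l subn_gt0.
Qed.

Lemma mul_atomic (f : {poly int}) : 0 < f.[0] ->
  exists2 s : seq {poly int}, {in s, forall a, atom_in mulS Sstar a} &
    f = \prod_(a <- s) a.
Proof.
have [n] := ubnP (norm_size f); elim: n f => // n IHn f fn f0.
have [->|/eqP f1] := eqVneq f 1; first by exists [::]; rewrite ?big_nil.
have [fA|fA] := pselect (atom_in mulS Sstar f).
  by exists [:: f]; rewrite ?big_seq1 // => a; rewrite inE => /eqP->.
have [b [c [/mul_nonunitE[b0 b1] /mul_nonunitE[c0 c1] /= fE]]] :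
    exists b c, [/\ nonunit_in mulS Sstar b, nonunit_in mulS Sstar c
      & f = mulS b c].
  by apply: contrapT => nf; apply: fA; split=> //; exact/mul_nonunitE.
rewrite fE ltnS in fn.
have [|//|s sA bE] := IHn b.
  exact: leq_trans (norm_size_lt_mul b0 c0 c1) fn.
have [|//|t tA cE] := IHn c.
  by rewrite mulrC in fn; exact: leq_trans (norm_size_lt_mul c0 b0 b1) fn.
exists (s ++ t); last by rewrite big_cat /= -bE -cE.
by move=> a; rewrite mem_cat => /orP[/sA|/tA].
Qed.

Lemma half_factorial_mul : half_factorial mulS Sstar.
Proof.
split=> [f /mul_nonunitE[f0 _]|f _ s t]; first exact: mul_atomic.
move=> [sA [u /mul_unitE-> /= ->]] [tA [v /mul_unitE-> /=]].
rewrite !mul1r; exact: mul_atom_factorization_size.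
Qed.

(** * Embedding into the real numbers *)

Lemma semiring_isomorphic_image (A B : pzSemiRingType) (D : {pred A})
    (phi : {rmorphism A -> B}) : semiring_closed D -> {in D &, injective phi} ->
  exists T : {pred B}, [/\ semiring_closed T, semiring_isomorphic D T &
    {in D, forall f, phi f \in T}].
Proof.
move=> [[D0 DD] [D1 DM]] phiI.
(* Membership in the image must be Boolean, so the existence of a preimage is decided
   classically. *)
pose T : {pred B} := fun y => `[< exists2 f, f \in D & phi f = y >].
have TP y : reflect (exists2 f, f \in D & phi f = y) (y \in T).
  exact: asboolP.
exists T; split; last by move=> f fD; apply/TP; exists f.
- split; split.
  + by apply/TP; exists 0; rewrite ?rmorph0.
  + move=> _ _ /TP[f fD <-] /TP[g gD <-].
    by apply/TP; exists (f + g); rewrite ?rmorphD //; exact: DD.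
  + by apply/TP; exists 1; rewrite ?rmorph1.
  + move=> _ _ /TP[f fD <-] /TP[g gD <-].
    by apply/TP; exists (f * g); rewrite ?rmorphM //; exact: DM.
- exists phi; split=> //; first by rewrite rmorph0 rmorph1.
  + by move=> f g _ _; exact: rmorphD.
  + by move=> f g _ _; exact: rmorphM.
  + by move=> y; split=> /TP.
Qed.

Theorem mainTheorem3 :
  [/\ semidomain pos_const_poly,
      bi_HFS pos_const_poly &
      forall R : realType, exists T : {pred R},
        [/\ semiring_closed T,
            semiring_isomorphic pos_const_poly T &
            ~ (T =i (Num.nat : {pred R}))]].
Proof.
split; [exact: semidomain_pos_const_poly|split|move=> R].
- exact: half_factorial_add.
- exact: half_factorial_mul.
have [alpha alphaP] := exists_transcendental R.
pose phi : {rmorphism {poly int} -> R} := horner_eval alpha \o map_poly intr.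
have phiI : injective phi.
  (* Transcendence of [alpha] says that evaluation has trivial kernel. *)
  apply: raddf_inj => p /eqP; exact: alphaP.
have [T [Tclosed Tiso phiT]] :=
  semiring_isomorphic_image semidomain_pos_const_poly (in2W phiI).
exists T; split=> // TN.
have /natrP[n] : phi ('X + 1) \in Num.nat.
  by rewrite -TN phiT // mem_pos_const_poly !hornerE.
rewrite -(rmorph_nat phi) => /phiI /(congr1 (coefp 1)) /=.
by rewrite coefD coefX coefC -polyCMn coefC.
Qed.
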